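(* Let $r$ be a $d$-variate ($d\ge 3$) tail copula density and let $\mathcal V=(T_j)_{j=1}^{d-1}$ with $T_j=(N_j,E_j)$ be a regular vine sequence on $[d]$. For $x\in(0,\infty)^d$, we have $$r(x)=\prod_{e\in E_1} r_{a_e,b_e}(x_{a_e},x_{b_e})\cdot\prod_{j=2}^{d-1}\prod_{e\in E_j} c_{a_e,b_e;D_e}\Big(R_{a_e|D_e}(x_{a_e}\mid x_{D_e}),\,R_{b_e|D_e}(x_{b_e}\mid x_{D_e});\,x_{D_e}\Big),$$ where, for $e=(a_e,b_e;D_e)\in E_2\cup\dots\cup E_{d-1}$, the pair copula density $c_{a_e,b_e;D_e}$ is $$c_{a_e,b_e;D_e}(u_{a_e},u_{b_e};x_{D_e})=\frac{r_{a_e,b_e|D_e}(x_{a_e},x_{b_e}\mid x_{D_e})}{r_{a_e|D_e}(x_{a_e}\mid x_{D_e})\cdot r_{b_e|D_e}(x_{b_e}\mid x_{D_e})},$$ with $x_{a_e}=R^{-1}_{a_e|D_e}(u_{a_e}\mid x_{D_e})$ and $x_{b_e}=R^{-1}_{b_e|D_e}(u_{b_e}\mid x_{D_e})$ for $u_{a_e},u_{b_e}\in(0,1)$.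
   Context: Notation: $[d]=\{1,\dots,d\}$; $x_J=(x_j)_{j\in J}$; in subscripts $i$ stands for $\{i\}$ and $a,b$ for $\{a,b\}$. Tail copula densities. A $d$-variate tail copula density is a continuous function $r:(0,\infty)^d\to[0,\infty)$ such that (a) $\int_{(0,\infty)^{d-1}} r(x)\,dx_{[d]\setminus\{j\}}=1$ for every $j\in[d]$ and every $x_j\in(0,\infty)$, and (b) $r(sx)=s^{1-d}r(x)$ for all $s\in(0,\infty)$ and $x\in(0,\infty)^d$. For non-empty $J\subseteq[d]$, the margin $r_J$ is obtained by integrating out the variables with indices not in $J$: $r_J(x_J)=\int_{(0,\infty)^{d-|J|}} r(x)\,dx_{[d]\setminus J}$ (and $r_{[d]}=r$). For disjoint non-empty $I,J\subset[d]$ and $x_J$ such that $r_J(x_J)>0$, set $r_{I|J}(x_I|x_J)=r_{I\cup J}(x_{I\cup J})/r_J(x_J)$; as a function of $x_I$ this is a probability density on $(0,\infty)^I$. For $I=\{i\}$, $R_{i|J}(x_i|x_J)=\int_0^{x_i}r_{i|J}(t|x_J)\,dt$ is the corresponding distribution function in $x_i$, and $u_i\mapsto R^{-1}_{i|J}(u_i|x_J)$ is its quantile function. Regular vines. A tree is a connected acyclic graph $T=(N,E)$, edges being two-element subsets of the finite node set $N$. A regular vine sequence on $[d]$ is $\mathcal V=(T_1,\dots,T_{d-1})$ where $T_1=(N_1,E_1)$ is a tree with $N_1=[d]$ and, for $j\in\{2,\dots,d-1\}$, $T_j=(N_j,E_j)$ is a tree with $N_j=E_{j-1}$ such that $|a\cap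 b|=1$ for every $\{a,b\}\in E_j$. The complete union of an edge $e$ is $A_e=e$ if $e\in E_1$ and $A_e=A_a\cup A_b$ if $e=\{a,b\}\in E_j$, $j\ge2$. For $e=\{a,b\}\in E_j$, $j\ge2$, the conditioning set is $D_e=A_a\cap A_b$ and the conditioned set is $(A_a\setminus A_b)\cup(A_b\setminus A_a)$, which has exactly two elements $a_e<b_e$; for $e\in E_1$, $D_e=\emptyset$ and $e=\{a_e,b_e\}$ with $a_e<b_e$. One writes $e=(a_e,b_e;D_e)$.
   Formalization: The identity is stated at points x where the margins of r over the complete unions A_e of the vine's edges are finite (they can be infinite for a tail copula density, making the right side undefined); c is set to 0 outside (0,1)^2 and conditional densities to 0 where the margin r_J(x_J) vanishes. *)

(* Defs.v *)
From HB Require Import structures.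
From mathcomp Require Import all_boot all_order all_algebra.
From mathcomp Require Import all_classical all_reals all_analysis.

Set Implicit Arguments.
Unset Strict Implicit.
Unset Printing Implicit Defensive.

Import Order.TTheory GRing.Theory Num.Theory.
Import numFieldNormedType.Exports.

Local Open Scope classical_set_scope.
Local Open Scope ring_scope.

(** * Tail copula densities *)

Section TailCopulaDensity.
Context {R : realType} {d : nat}.
Implicit Types (r : 'rV[R]_d -> R) (x : 'rV[R]_d) (I J D : {set 'I_d}).
Implicit Types (a b i : 'I_d) (s t u v : R).

Definition orthant : set 'rV[R]_d := [set x | forall i, 0 < x 0 i].

Definition upd x i t : 'rV[R]_d := \row_k (if k == i then t else x 0 k).

(* Lebesgue integral of a nonnegative f over (0,oo)^s with respect to the
   coordinates listed in s, the others being fixed to those of x; by Tonelli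
   the order of s does not matter. *)
Fixpoint int_coords (f : 'rV[R]_d -> \bar R) (s : seq 'I_d) x : \bar R :=
  if s is i :: s' then
    (\int[lebesgue_measure]_(t in `]0%R, +oo[) int_coords f s' (upd x i t))%E
  else f x.

(* r_J(x_J), as a function of the whole vector x of which only the coordinates
   in J matter.  The integral may be +oo at some points, even when r is a tail
   copula density. *)
Definition emargin r J x : \bar R := int_coords (EFin \o r) (enum (~: J)) x.

(* Real-valued version, with the junk value 0 where the integral diverges. *)
Definition margin r J x : R := fine (emargin r J x).

(* Only the values of r on the orthant are relevant. *)
Definition tail_copula_density r : Prop :=
  [/\ {in orthant, continuous r},
      forall x, orthant x -> 0 <= r x,
      forall j x, orthant x -> emargin r [set j]%SET x = 1%E &
      forall s x, 0 < s -> orthant x -> r (s *: x) = s^-1 ^+ d.-1 * r x].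

(* r_{I|J}(x_I | x_J), equal to 0 when r_J(x_J) = 0 (y / 0 = 0). *)
Definition cond_density r I J x : R := margin r (I :|: J)%SET x / margin r J x.

(* R_{i|J}(t | x_J) *)
Definition cond_cdf r i J t x : R :=
  \int[lebesgue_measure]_(s in `]0, t]) cond_density r [set i]%SET J (upd x i s).

(* R^{-1}_{i|J}(u | x_J) *)
Definition cond_quantile r i J u x : R :=
  inf [set t | 0 < t /\ u <= cond_cdf r i J t x].

(* c_{a,b;D}(u, v; x_D).  As a density on the unit square, it is extended by 0
   outside (0,1)^2, where the quantiles need not be points of (0,oo). *)
Definition pair_copula_density r a b D u v x : R :=
  if (0 < u < 1) && (0 < v < 1) then
    let y := upd (upd x a (cond_quantile r a D u x)) b (cond_quantile r b D v x)
    in cond_density r [set a; b]%SET D y /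
         (cond_density r [set a]%SET D y * cond_density r [set b]%SET D y)
  else 0.

End TailCopulaDensity.

(** * Regular vines *)

Record graph (T : finType) :=
  Graph { nodes : {set T} ; edges : {set {set T}} }.

Definition adj (T : finType) (G : graph T) : rel T :=
  [rel x y | [set x; y]%SET \in edges G].

Definition is_tree (T : finType) (G : graph T) : Prop :=
  [/\ forall e, e \in edges G -> e \subset nodes G /\ #|e| = 2%N,
      {in nodes G &, forall x y, connect (adj G) x y} &
      forall p : seq T, (2 < size p)%N -> ~ ucycle (adj G) p].

(* Edges are sets of two nodes, and the edges of each tree are the nodes of the
   next one: the nodes of T_{j+1} have type [vnode d j], its edges have type
   [vnode d j.+1]. *)
Fixpoint vnode (d j : nat) : finType :=
  if j is j'.+1 then {set vnode d j'} else 'I_d.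

(* V j is the tree T_{j+1}; only V 0, ..., V d.-2 are constrained. *)
Definition regular_vine (d : nat) (V : forall j, graph (vnode d j)) : Prop :=
  [/\ forall j, (j < d.-1)%N -> is_tree (V j),
      nodes (V 0%N) = [set: 'I_d]%SET,
      forall j, (j.+1 < d.-1)%N -> nodes (V j.+1) = edges (V j) &
      forall j, (j.+1 < d.-1)%N -> forall a b : {set vnode d j},
        [set a; b]%SET \in edges (V j.+1) -> #|(a :&: b)%SET| = 1%N].

(* A_e, with the convention A_i = {i} for i in [d], so that A_e = e for
   e in E_1. *)
Fixpoint complete_union (d j : nat) : vnode d j -> {set 'I_d} :=
  match j return vnode d j -> {set 'I_d} with
  | 0 => fun i : 'I_d => [set i]%SET
  | j'.+1 => fun e : {set vnode d j'} =>
      (\bigcup_(a in e) complete_union a)%SET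
  end.

(* D_e; empty for e in E_1, as the A_i are then disjoint. *)
Definition conditioning_set (d j : nat) (e : vnode d j.+1) : {set 'I_d} :=
  (\bigcap_(a in (e : {set vnode d j})) complete_union a)%SET.

(* For e = {a,b} this is (A_a \ A_b) U (A_b \ A_a). *)
Definition conditioned_set (d j : nat) (e : vnode d j.+1) : {set 'I_d} :=
  (\bigcup_(a in (e : {set vnode d j})) \bigcup_(b in (e : {set vnode d j}))
     (complete_union a :\: complete_union b))%SET.

(* a_e < b_e: [enum] lists a set of ordinals in increasing order; the default
   value ord0 is not used on edges of a regular vine. *)
Definition cond_fst (n j : nat) (e : vnode n.+1 j.+1) : 'I_n.+1 :=
  nth ord0 (enum (conditioned_set e)) 0.
Definition cond_snd (n j : nat) (e : vnode n.+1 j.+1) : 'I_n.+1 :=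
  nth ord0 (enum (conditioned_set e)) 1.

(* Main.v *)
Require Import Defs.
From HB Require Import structures.
From mathcomp Require Import all_boot all_order all_algebra.
From mathcomp Require Import all_classical all_reals all_analysis.
From mathcomp Require Import measurable_realfun zify ring lra.

Set Implicit Arguments.
Unset Strict Implicit.
Unset Printing Implicit Defensive.

Import Order.TTheory GRing.Theory Num.Theory.
Import numFieldNormedType.Exports.

Local Open Scope ring_scope.

(** Combinatorics.  An edge e = {a, b} of T_{j+1} is centred at the common end c
of a and b in T_j.  Edges centred at c form a forest on the deg(c) edges through
c, and summing over c shows that there are exactly deg(c) - 1 of them.  The same
count restricted to the nodes v with z in A_v shows that these nodes span a
subtree and that z in A_a and A_b forces z in A_c, whence D_e = A_c.  Therefore
the product of r_{A_e} r_{D_e} / (r_{A_a} r_{A_b}) over e in T_{j+1} only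
involves node margins with powers of their degrees, and telescopes over j.

Analysis.  Margins need be neither continuous nor finite, but by Fatou they are
lower semicontinuous; this gives all the measurability needed for Tonelli and
implies that a positive density at x_a makes the conditional distribution
function strictly increasing at x_a, so that the quantile gives x_a back.  If
r(x) > 0, all margins are positive at x and the formula telescopes.  If
r(x) = 0, the factor of the last edge vanishes: if its arguments lie in (0,1),
either the quantiles give x back and its numerator is r(x), or some quantile is
a point where, by lower semicontinuity, the conditional density is 0. *)

(** * Trees *)

Section Trees.
Context {T : finType} (G : graph T) (hG : is_tree G).
Local Open Scope set_scope.
Local Open Scope nat_scope.
Implicit Types (S e : {set T}) (x y : T).

Definition inner S : {set {set T}} := [set e in edges G | e \subset S].

Definition degree x : nat := \sum_(e in edges G) (x \in e).

Lemma edge_card e : e \in edges G -> #|e| = 2.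
Proof. by case: hG => h _ _ /h []. Qed.

Lemma edge_nodes e x : e \in edges G -> x \in e -> x \in nodes G.
Proof. by case: hG => h _ _ /h [/fintype.subsetP s _] /s. Qed.

Lemma adj_sym x y : adj G x y = adj G y x.
Proof. by rewrite /adj /= finset.setUC. Qed.

Lemma adj_neq x y : adj G x y -> x != y.
Proof. by move/edge_card; rewrite cards2; case: eqVneq. Qed.

Lemma edge_other_end e x : e \in edges G -> x \in e ->
  exists2 y, adj G x y & e = [set x; y].
Proof.
move=> eE xe; have := edge_card eE; rewrite (cardsD1 x) xe => -[] /eqP/cards1P[y ey].
have ee : e = [set x; y] by rewrite -ey finset.setD1K.
by exists y; rewrite // /adj /= -ee.
Qed.

(** If every vertex of S had two induced edges, a path in S could be prolonged forever without
    turning back; acyclicity would keep its vertices distinct, against the finiteness of T. *)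
Lemma exists_leaf S : S != finset.set0 ->
  exists2 x, x \in S & #|[set e in inner S | x \in e]| <= 1.
Proof.
move=> /set0Pn[x0 x0S].
have [/existsP[x /andP[xS xl]]|/existsPn noleaf] :=
  boolP [exists x, (x \in S) && (#|[set e in inner S | x \in e]| <= 1)].
  by exists x.
have step x z : x \in S -> exists w, [/\ w \in S, adj G x w & w != z].
  move=> xS; have := noleaf x; rewrite xS /= -ltnNge => /card_gt1P[e [f []]].
  rewrite !inE => /andP[/andP[eE eS] xe] /andP[/andP[fE fS] xf] nef.
  have [w xw ew] := edge_other_end eE xe; have [v xv fv] := edge_other_end fE xf.
  have [wz|wz] := eqVneq w z; last first.
    by exists w; split=> //; apply: (fintype.subsetP eS); rewrite ew !inE eqxx orbT.
  exists v; split=> //; first by apply: (fintype.subsetP fS); rewrite fv !inE eqxx orbT.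
  by apply: contra_neq nef => vz; rewrite ew fv vz wz.
have long k : exists x s, [/\ path (adj G) x s, uniq (x :: s),
    {subset x :: s <= S} & size s = k].
  elim: k => [|k [x [s [ps us sS ss]]]].
    by exists x0, [::]; split=> // y; rewrite inE => /eqP->.
  have [w [wS xw wz]] := step x (head x s) (sS _ (mem_head _ _)).
  exists w, (x :: s); split=> //=; last 1 first.
  - by rewrite ss.
  - by rewrite adj_sym xw.
  - rewrite -/(uniq (x :: s)) us andbT inE negb_or eq_sym (adj_neq xw) /=.
    (* If w is already on the path, the stretch from x to w closes up to a cycle. It has at least
       three vertices: [s1] is non-empty because w is not the vertex [head x s] visited just before
       x. *)
    apply/negP => ws; case/splitPr: ws ps us wz {sS ss} => s1 s2 ps us wz.
    have [_ _ /(_ (x :: rcons s1 w))] := hG; apply.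
      by case: s1 wz {ps us} => [|? ?] //=; rewrite ?eqxx // size_rcons.
    apply/andP; split; last first.
      by move: us; rewrite -cat_rcons -cat_cons cat_uniq => /and3P[].
    rewrite /cycle rcons_path last_rcons adj_sym xw andbT.
    by move: ps; rewrite -cat_rcons cat_path => /andP[].
  - by move=> y; rewrite inE => /predU1P[->//|/sS].
have [x [s [_ /card_uniqP us _ ss]]] := long #|T|.
by have := max_card (mem (x :: s)); rewrite us /= ss ltnn.
Qed.

(** Removing a leaf loses one vertex and at most one induced edge. *)
Lemma forest_card S : S != finset.set0 -> #|inner S| < #|S|.
Proof.
have [k] := ubnP #|S|; elim: k S => // k IH S Sk S0.
have [x xS xl] := exists_leaf S0.
have [S10|S1] := eqVneq (S :\ x) finset.set0.
  have -> : inner S = finset.set0.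
    apply/finset.setP => e; rewrite !inE; apply/negP => /andP[/edge_card e2 /subset_leq_card].
    by rewrite e2 (cardsD1 x S) xS S10 cards0.
  by rewrite cards0 card_gt0.
have sk : #|S| = #|S :\ x|.+1 by rewrite (cardsD1 x) xS.
have h : #|inner (S :\ x)| < #|S :\ x| by apply: IH => //; rewrite -ltnS -sk.
have : #|inner S| <= #|inner (S :\ x) :|: [set e in inner S | x \in e]|.
  apply/subset_leq_card/fintype.subsetP => e; rewrite !inE subsetD1 => /andP[-> ->] /=.
  by case: (x \in e).
have [+ _] := leq_card_setU (inner (S :\ x)) [set e in inner S | x \in e].
lia.
Qed.

Lemma path_crossing (e : rel T) S x p : path e x p -> x \in S -> last x p \notin S ->
  exists u v, [/\ u \in S, v \notin S & e u v].
Proof.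
elim: p x => [|y p IH] x /=; first by move=> _ ->.
case/andP => xy yp xS lS; have [yS|yS] := boolP (y \in S); first exact: IH yp yS lS.
by exists x, y.
Qed.

Lemma boundary_edge S x y : S \subset nodes G -> x \in S -> y \in nodes G ->
  y \notin S -> exists u v, [/\ u \in S, v \in nodes G, v \notin S & adj G u v].
Proof.
move=> SN xS yN yS; have [_ /(_ x y (fintype.subsetP SN x xS) yN) /connectP[p px py] _] := hG.
have [u [v [uS vS uv]]] : exists u v, [/\ u \in S, v \notin S & adj G u v].
  by apply: path_crossing px xS _; rewrite -py.
exists u, v; split=> //; apply: (edge_nodes uv); by rewrite !inE eqxx orbT.
Qed.

(** Starting from one vertex, S can be enlarged by the outer end of a boundary edge, and this edge
    becomes a new induced edge. *)
Lemma connected_card : #|nodes G| <= #|edges G|.+1.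
Proof.
have [->|[x0 x0N]] := set_0Vmem (nodes G); first by rewrite cards0.
have build k : k < #|nodes G| ->
    exists S, [/\ S \subset nodes G, #|S| = k.+1 & k <= #|inner S|].
  elim: k => [|k IH] kN.
    by exists [set x0]; rewrite finset.sub1set x0N cards1.
  have [S [SN Sk Si]] := IH (ltnW kN).
  have [x xS] : exists x, x \in S by apply/set0Pn; rewrite -card_gt0 Sk.
  have /fintype.subsetPn[y yN yS] : ~~ (nodes G \subset S).
    by apply/negP => /subset_leq_card; lia.
  have [u [v [uS vN vS uv]]] := boundary_edge SN xS yN yS.
  exists (v |: S); split.
  - by rewrite finset.subUset finset.sub1set vN.
  - by rewrite cardsU1 vS Sk.
  - have : [set u; v] |: inner S \subset inner (v |: S).
      apply/fintype.subsetP => e; rewrite !inE => /orP[/eqP->|/andP[-> /=]].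
        rewrite [_ \in edges G]uv /=; apply/fintype.subsetP => w.
        by rewrite !inE => /orP[/eqP->|->//]; rewrite uS orbT.
      by move=> eS; apply: fintype.subset_trans eS (finset.subsetUr _ _).
    move/subset_leq_card; rewrite cardsU1 inE finset.subUset !finset.sub1set (negbTE vS).
    by rewrite !andbF /= add1n; apply: leq_trans.
have [|Nk] := posnP #|nodes G|; first by move=> ->.
have [|S [_ _ Si]] := build #|nodes G|.-1; first lia.
have : #|inner S| <= #|edges G|.
  by apply/subset_leq_card/fintype.subsetP => e; rewrite inE => /andP[].
lia.
Qed.

Lemma tree_card : nodes G != finset.set0 -> #|nodes G| = #|edges G|.+1.
Proof.
move=> N0; apply/eqP; rewrite eqn_leq connected_card.
apply: leq_ltn_trans (forest_card N0); apply/subset_leq_card/fintype.subsetP => e eE.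
by rewrite inE eE; apply/fintype.subsetP => x; apply: edge_nodes.
Qed.

Lemma degree_gt0 x : 1 < #|nodes G| -> x \in nodes G -> 0 < degree x.
Proof.
move=> N2 xN; have [|[y]] := set_0Vmem (nodes G :\ x).
  by move=> N0; move: N2; rewrite (cardsD1 x) xN N0 cards0.
rewrite inE => /andP[yx yN].
have [u [v [/set1P-> _ _ xv]]] : exists u v,
    [/\ u \in [set x], v \in nodes G, v \notin [set x] & adj G u v].
  by apply: (@boundary_edge [set x] x y) => //; rewrite ?finset.sub1set ?finset.in_set1.
by rewrite /degree (bigD1 [set x; v]) //= !inE eqxx.
Qed.

Lemma sum_degree S : \sum_(x in S) degree x = \sum_(e in edges G) #|e :&: S|.
Proof.
rewrite exchange_big /=; apply: eq_bigr => e _.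
rewrite -sum1_card [LHS]big_mkcond [RHS]big_mkcond; apply: eq_bigr => x _ /=.
by rewrite inE; case: (x \in S); case: (x \in e).
Qed.

End Trees.

(** * From a tree to the next one *)

Section LineGraph.
Context {T I : finType} (G : graph T) (G' : graph {set T}) (A : T -> {set I}).
Local Open Scope set_scope.
Local Open Scope nat_scope.
Hypotheses (hG : is_tree G) (hG' : is_tree G').
Hypothesis nodes' : nodes G' = edges G.
Hypothesis proximity : forall a b, [set a; b] \in edges G' -> #|a :&: b| = 1.

Definition lift_union (a : {set T}) : {set I} := \bigcup_(v in a) A v.

(** For an edge e = {a, b} of [G'] this says that v lies in both a and b; by proximity exactly one v
    does, the centre of e. *)
Definition common_end (e : {set {set T}}) v : bool := [forall a in e, v \in a].

Definition center_degree v : nat := \sum_(e in edges G') common_end e v.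

Lemma edge_pair e : e \in edges G' -> exists a b,
  [/\ e = [set a; b], a \in edges G, b \in edges G & a != b].
Proof.
move=> eE; have /eqP/cards2P[a [b [ab ee]]] := edge_card hG' eE.
exists a, b; split=> //; rewrite -nodes'; apply: (edge_nodes hG' eE);
  by rewrite ee !inE eqxx ?orbT.
Qed.

Lemma common_endP e : e \in edges G' -> exists2 c, c \in nodes G &
  forall v, common_end e v = (v == c).
Proof.
move=> eE; have [a [b [ee aE bE _]]] := edge_pair eE.
have /eqP/cards1P[c abc] : #|a :&: b| = 1 by apply: proximity; rewrite -ee.
exists c.
  have : c \in a :&: b by rewrite abc inE.
  by rewrite inE => /andP[ca _]; apply: (edge_nodes hG aE ca).
move=> v; rewrite -finset.in_set1 -abc finset.in_setI ee; apply/forall_inP/andP => [h|[va vb] x].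
  by split; apply: h; rewrite !inE eqxx ?orbT.
by rewrite !inE => /orP[] /eqP->.
Qed.

Lemma sum_center_degree (S : {set T}) : \sum_(v in S) center_degree v =
  #|[set e in edges G' | [exists v in S, common_end e v]]|.
Proof.
rewrite exchange_big /= -sum1dep_card big_mkcondr /=.
apply: eq_bigr => e eE; have [c _ cP] := common_endP eE.
under eq_bigr => v _ do rewrite cP.
have [cS|cS] := boolP (c \in S).
  rewrite (bigD1 c) //= eqxx big1; last by move=> v /andP[_ /negbTE->].
  by rewrite ifT //; apply/exists_inP; exists c; rewrite ?cP.
rewrite big1; last by move=> v vS; case: eqP => // vc; rewrite -vc vS in cS.
by case: ifP => // /exists_inP[v vS]; rewrite cP => /eqP vc; rewrite -vc vS in cS.
Qed.

Hypothesis edges_gt1 : 1 < #|edges G|.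

Lemma nodes_neq0 : nodes G != finset.set0.
Proof.
have /set0Pn[e eE] : edges G != finset.set0 by rewrite -card_gt0; lia.
have /card_gt0P[x xe] : 0 < #|e| by rewrite (edge_card hG eE).
by apply/set0Pn; exists x; apply: edge_nodes hG _ _ eE xe.
Qed.

(** The edges of [G'] centred at v are induced on the set of edges of [G] through v, which is
    non-empty, so the forest bound applies. *)
Lemma center_degree_lt v : v \in nodes G -> center_degree v < degree G v.
Proof.
move=> vN.
have -> : degree G v = #|[set e in edges G | v \in e]|.
  by rewrite -sum1dep_card big_mkcondr.
have S0 : [set e in edges G | v \in e] != finset.set0.
  rewrite -card_gt0 -sum1dep_card big_mkcondr /=; apply: (degree_gt0 hG _ vN).
  by rewrite (tree_card hG nodes_neq0); lia.
apply: leq_ltn_trans (forest_card hG' S0).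
have -> : center_degree v = #|[set e in edges G' | common_end e v]|.
  by rewrite -sum1dep_card big_mkcondr.
apply/subset_leq_card/fintype.subsetP => e; rewrite !inE => /andP[eE /forall_inP ve].
rewrite eE; apply/fintype.subsetP => a ae; rewrite inE ve // andbT.
by rewrite -nodes'; apply: edge_nodes hG' _ _ eE ae.
Qed.

(* The edges of the next tree centred at v form a forest on the edges of G
   through v, whence one inequality for every v; the sums over v agree. *)
Lemma degree_center v : v \in nodes G -> degree G v = (center_degree v).+1.
Proof.
(* Both sums equal 2|E|: the degrees count every edge of [G] twice, and the left side is |E'| + |N|
   with |N| = |E| + 1 and |E'| = |E| - 1. *)
have sumE : \sum_(v in nodes G) (center_degree v).+1 = \sum_(v in nodes G) degree G v.
  under eq_bigr do rewrite -addn1.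
  rewrite sum_degree // big_split /= sum1_card sum_center_degree.
  have -> : [set e in edges G' | [exists v in nodes G, common_end e v]] = edges G'.
    apply/finset.setP => e; rewrite inE andb_idr // => eE.
    by have [c cN cP] := common_endP eE; apply/exists_inP; exists c; rewrite ?cP.
  rewrite (eq_bigr (fun=> 2)); last first.
    move=> e eE; rewrite -(edge_card hG eE); congr #|pred_of_set _|; apply/finset.setIidPl.
    by apply/fintype.subsetP => x; apply: edge_nodes hG _ _ eE.
  have E0 : nodes G' != finset.set0 by rewrite nodes' -card_gt0; lia.
  have h' := tree_card hG' E0; rewrite nodes' in h'.
  rewrite sum_nat_const (tree_card hG nodes_neq0) h'.
  by move: #|edges G'| => k; lia.
move=> vN; apply/eqP; rewrite eqn_leq center_degree_lt // andbT leqNgt; apply/negP => lt.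
have : \sum_(v in nodes G) (center_degree v).+1 < \sum_(v in nodes G) degree G v.
  rewrite (bigD1 v) //= [X in _ < X](bigD1 v) //= -addSn leq_add //.
  by apply: leq_sum => w /andP[wN _]; apply: center_degree_lt.
by rewrite sumE ltnn.
Qed.

(** In a tree H induced subgraphs are forests, so this count encodes that the nodes v with z in B v
    span a connected subgraph. *)
Definition subtrees (T0 : finType) (H : graph T0) (B : T0 -> {set I}) := forall z,
  let S := [set v in nodes H | z \in B v] in
  S != finset.set0 -> #|inner H S|.+1 = #|S|.

Hypothesis hA : subtrees G A.

Lemma mem_lift_union z a : z \in lift_union a = [exists v in a, z \in A v].
Proof. by apply/finset.bigcupP/exists_inP => -[v va zv]; exists v. Qed.

(** Let C be the set of edges of [G'] centred in S. Counting incidences gives |S'| + |inner G S| =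
    |C| + |S|, hence |S'| = |C| + 1 as S spans a subtree. Since C lies in [inner G' S'], which as a
    forest has fewer than |S'| edges, the two coincide. *)
Lemma subtrees_step z :
  let S := [set v in nodes G | z \in A v] in
  let S' := [set a in nodes G' | z \in lift_union a] in
  S' != finset.set0 -> #|inner G' S'|.+1 = #|S'| /\
    inner G' S' = [set e in edges G' | [exists v in S, common_end e v]].
Proof.
move=> S S' S'0.
have memS a v : a \in edges G -> v \in a -> (v \in S) = (z \in A v).
  by move=> aE va; rewrite inE (edge_nodes hG aE va).
have S0 : S != finset.set0.
  case/set0Pn: S'0 => a; rewrite inE nodes' mem_lift_union => /andP[aE /exists_inP[v va zv]].
  by apply/set0Pn; exists v; rewrite (memS a).
(* The number of ends of an edge a in S is 1 if a meets S, plus 1 if a lies inside S. *)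
have cS' : #|S'| + #|inner G S| = \sum_(v in S) degree G v.
  rewrite sum_degree // /S' nodes' -!sum1dep_card !big_mkcondr -big_split /=.
  apply: eq_bigr => a aE; have /eqP/cards2P[x [y [xy ae]]] := edge_card hG aE.
  have xa : x \in a by rewrite ae !inE eqxx.
  have ya : y \in a by rewrite ae !inE eqxx orbT.
  have -> : z \in lift_union a = (x \in S) || (y \in S).
    rewrite mem_lift_union !(memS a) //; apply/exists_inP/orP.
      by move=> [v]; rewrite ae !inE => /orP[] /eqP->; [left|right].
    by case=> h; [exists x|exists y].
  have -> : a \subset S = (x \in S) && (y \in S).
    by rewrite ae finset.subUset !finset.sub1set.
  have -> : #|a :&: S| = (x \in S) + (y \in S).
    rewrite -sum1_card (eq_bigl (fun v => (v \in a) && (v \in S))); last first.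
      by move=> v; rewrite finset.in_setI.
    rewrite big_mkcondr /= ae big_setU1 ?finset.in_set1 //= big_set1.
    by case: (x \in S); case: (y \in S).
  by case: (x \in S); case: (y \in S).
have := hA S0; rewrite -/S => cS.
have {}cS' : #|S'| + #|inner G S| =
    #|[set e in edges G' | [exists v in S, common_end e v]]| + #|S|.
  rewrite cS' -sum_center_degree -sum1_card -big_split /=.
  by apply: eq_bigr => v; rewrite inE addn1 => /andP[vN _]; apply: degree_center.
set C := [set e in edges G' | _] in cS' *.
have sub : C \subset inner G' S'.
  apply/fintype.subsetP => e; rewrite !inE => /andP[eE /exists_inP[v vS /forall_inP ve]].
  rewrite eE; apply/fintype.subsetP => a ae; rewrite inE (edge_nodes hG' eE ae) mem_lift_union.
  apply/exists_inP; exists v; first exact: ve.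
  by move: vS; rewrite inE => /andP[].
have := subset_leq_card sub; have := forest_card hG' S'0 => h1 h2.
have cC : #|inner G' S'| = #|C| by lia.
split; first by rewrite cC; lia.
by apply/esym/eqP; rewrite eqEcard sub cC leqnn.
Qed.

Lemma subtrees_lift : subtrees G' lift_union.
Proof. by move=> z S /subtrees_step[]. Qed.

(** If z is in the union of every a in e, then e belongs to [inner G' S'] and is centred in S; the
    centre being unique, it is c, so z is in A c. *)
Lemma bigcap_lift_union e c : e \in edges G' -> common_end e c ->
  \bigcap_(a in e) lift_union a = A c.
Proof.
move=> eE ec; apply/finset.setP => z; apply/finset.bigcapP/idP => [h|zc a ae]; last first.
  by rewrite mem_lift_union; apply/exists_inP; exists c => //; move/forall_inP: ec; apply.
set S' := [set a in nodes G' | z \in lift_union a].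
have eS' : e \in inner G' S'.
  rewrite inE eE; apply/fintype.subsetP => a ae.
  by rewrite inE (edge_nodes hG' eE ae) h.
have S'0 : S' != finset.set0.
  have [a [b [ee _ _ _]]] := edge_pair eE; apply/set0Pn; exists a.
  move: eS'; rewrite inE => /andP[_ /fintype.subsetP]; apply.
  by rewrite ee !inE eqxx.
have [_ S'E] := subtrees_step S'0; move: eS'; rewrite S'E inE => /andP[_ /exists_inP[v]].
have [c' _ cP] := common_endP eE.
rewrite inE => /andP[_ zv]; rewrite cP => /eqP vc; move: ec.
by rewrite cP -vc => /eqP->.
Qed.

End LineGraph.

(** * Regular vines *)

Section VineCombinatorics.
Local Open Scope set_scope.
Local Open Scope nat_scope.

Lemma lift_union2 (T I : finType) (A : T -> {set I}) a b : a != b ->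
  lift_union A [set a; b] = A a :|: A b.
Proof. by move=> ab; rewrite /lift_union big_setU1 ?finset.in_set1 // big_set1. Qed.

(** The sizes k + 1, k + 1 and k + 2 leave k elements in the intersection D, so each of the two
    differences is a single element. *)
Lemma edge_shape n j (e : vnode n.+1 j.+1) k :
  #|(e : {set vnode n.+1 j})| = 2 ->
  (forall a, a \in (e : {set vnode n.+1 j}) -> #|complete_union a| = k.+1) ->
  #|complete_union e| = k.+2 ->
  let D := conditioning_set e in let p := cond_fst e in let q := cond_snd e in
  [/\ p != q, p \notin D, q \notin D & exists a b : vnode n.+1 j,
    [/\ e = [set a; b], a != b, complete_union a = p |: D & complete_union b = q |: D]].
Proof.
move=> /eqP/cards2P[a [b [ab ee]]] cA cE D p q.
have := cE; rewrite {1}ee => /= cE'.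
rewrite -/(lift_union (@complete_union n.+1 j) _) lift_union2 // cardsU in cE'.
have Ca : #|complete_union a| = k.+1 by apply: cA; rewrite ee !inE eqxx.
have Cb : #|complete_union b| = k.+1 by apply: cA; rewrite ee !inE eqxx orbT.
have DE : D = complete_union a :&: complete_union b.
  rewrite /D /conditioning_set; move: (e) ee => e' ->.
  by rewrite big_setU1 ?finset.in_set1 // big_set1.
rewrite -DE in cE'.
have /eqP/cards1P[p' pE] : #|complete_union a :\: complete_union b| = 1.
  by have := cardsID (complete_union b) (complete_union a); rewrite -DE Ca; lia.
have /eqP/cards1P[q' qE] : #|complete_union b :\: complete_union a| = 1.
  by have := cardsID (complete_union a) (complete_union b); rewrite finset.setIC -DE Cb; lia.
have aE : complete_union a = p' |: D.
  by rewrite finset.setUC -pE DE finset.setID.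
have bE : complete_union b = q' |: D.
  by rewrite finset.setUC -qE DE finset.setIC finset.setID.
have : p' \in complete_union a :\: complete_union b by rewrite pE finset.in_set1.
rewrite finset.in_setD => /andP[p'b p'a].
have : q' \in complete_union b :\: complete_union a by rewrite qE finset.in_set1.
rewrite finset.in_setD => /andP[q'a q'b].
have p'D : p' \notin D by rewrite DE finset.in_setI (negbTE p'b) andbF.
have q'D : q' \notin D by rewrite DE finset.in_setI (negbTE q'a).
have pq' : p' != q' by apply: contraNneq q'a => <-.
have condE : conditioned_set e = [set p'; q'].
  rewrite /conditioned_set; move: (e) ee => e' ->.
  rewrite big_setU1 ?finset.in_set1 // big_set1 !big_setU1 ?finset.in_set1 // !big_set1.
  by rewrite !finset.setDv pE qE /= finset.set0U finset.setU0.
(* [enum] may list p' and q' in either order; in one of the two cases a and b exchange roles. *)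
have : perm_eq (enum (conditioned_set e)) [:: p'; q'].
  apply: uniq_perm; rewrite ?enum_uniq //= ?inE ?pq' // => z.
  by rewrite mem_enum condE !inE.
move=> en; have := perm_size en; have := perm_mem en.
rewrite {}/p {}/q /cond_fst /cond_snd.
have := enum_uniq (conditioned_set e).
case: (enum _) => [|u [|v []]] //=; rewrite inE andbT => uv memuv _.
have := memuv u; have := memuv v; rewrite !inE !eqxx ?orbT /=.
move=> /esym/orP[] /eqP vE /esym/orP[] /eqP uE; rewrite {memuv}uE {}vE ?eqxx // in uv *.
- by split=> //; exists b, a; rewrite finset.setUC eq_sym.
- by split=> //; exists a, b.
Qed.

Variables (n : nat) (V : forall j, graph (vnode n.+1 j)).
Hypothesis hV : regular_vine V.

Lemma vine_tree j : j < n -> is_tree (V j).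
Proof. by case: hV => h _ _ _ /h. Qed.

Lemma vine_nodes j : j.+1 < n -> nodes (V j.+1) = edges (V j).
Proof. by case: hV => _ _ h _; apply: h. Qed.

Lemma vine_proximity j a b : j.+1 < n -> [set a; b] \in edges (V j.+1) -> #|a :&: b| = 1.
Proof. by case: hV => _ _ _ h jn; apply: h. Qed.

(** The claims need a joint induction: the subtree property gives D_e = A_c for a node c of the tree
    below, and then inclusion-exclusion gives the size of A_e. *)
Lemma vine_invariant j : j < n ->
  [/\ subtrees (V j) (@complete_union n.+1 j),
      #|edges (V j)| = n - j,
      forall a, a \in nodes (V j) -> #|complete_union a| = j.+1 &
      forall e, e \in edges (V j) -> #|@complete_union n.+1 j.+1 e| = j.+2].
Proof.
elim: j => [|j IH] jn.
  have T0 := vine_tree jn.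
  have N0 : nodes (V 0) = [set: 'I_n.+1] by case: hV.
  split=> [z S _|||].
  - have -> : S = [set z] by apply/finset.setP => i; rewrite inE N0 !inE eq_sym.
    rewrite cards1; congr _.+1; apply/eqP; rewrite cards_eq0; apply/eqP/finset.setP => e.
    rewrite !inE; apply/negP => /andP[/(edge_card T0) e2 /subset_leq_card].
    by rewrite e2 cards1.
  - have := tree_card T0; rewrite N0 cardsT card_ord subn0.
    by rewrite -card_gt0 cardsT card_ord => /(_ isT) [<-].
  - by move=> a _; rewrite /= cards1.
  - move=> e eE; have /eqP/cards2P[a [b [ab ee]]] := edge_card T0 eE.
    by rewrite ee /= -/(lift_union _ _) lift_union2 //= cards2 ab.
have [hA cE cN cU] := IH (ltnW jn).
have Tj := vine_tree (ltnW jn); have Tj1 := vine_tree jn.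
have nodes' := vine_nodes jn; have prox a b := @vine_proximity j a b jn.
have E1 : 1 < #|edges (V j)| by rewrite cE; lia.
split.
- exact: (subtrees_lift Tj Tj1 nodes' prox E1 hA).
- have /(tree_card Tj1) : nodes (V j.+1) != finset.set0.
    by rewrite nodes' -card_gt0; apply: ltnW.
  by rewrite nodes'; move: cE #|edges (V j.+1)| => -> k; lia.
- by move=> a; rewrite nodes' => /cU.
- move=> e eE; have [a [b [ee aE bE ab]]] := edge_pair Tj1 nodes' eE.
  have [c cN' cP] := common_endP Tj Tj1 nodes' prox eE.
  have := bigcap_lift_union Tj Tj1 nodes' prox E1 hA eE.
  move=> /(_ c); rewrite cP eqxx => /(_ isT).
  rewrite ee big_setU1 ?finset.in_set1 // big_set1 => DE.
  rewrite -[LHS]/#|lift_union (@complete_union n.+1 j.+1) _| lift_union2 // cardsU.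
  by rewrite [_ :&: _]DE cN // !cU //; lia.
Qed.

Lemma vine_edge_shape j e : j < n -> e \in edges (V j) ->
  let D := @conditioning_set n.+1 j e in
  let p := @cond_fst n j e in let q := @cond_snd n j e in
  [/\ p != q, p \notin D, q \notin D & exists a b : vnode n.+1 j,
    [/\ e = [set a; b], a != b, complete_union a = p |: D & complete_union b = q |: D]].
Proof.
move=> jn eE; have [_ _ cN cU] := vine_invariant jn; have Tj := vine_tree jn.
apply: (edge_shape (k := j)).
- exact: edge_card Tj _ eE.
- by move=> a ae; apply: cN; apply: edge_nodes Tj _ _ eE ae.
- exact: cU.
Qed.
End VineCombinatorics.

Section VineEdges.
Local Open Scope set_scope.
Variables (n : nat) (V : forall j, graph (vnode n.+1 j)).
Hypothesis hV : regular_vine V.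

Lemma vine_edge_union j e : (j < n)%N -> e \in edges (V j) ->
  @complete_union n.+1 j.+1 e =
  [set @cond_fst n j e; @cond_snd n j e] :|: @conditioning_set n.+1 j e.
Proof.
move=> jn eE; have [_ _ _ [a [b [ee ab ua ub]]]] := vine_edge_shape hV jn eE.
have -> : @complete_union n.+1 j.+1 e = complete_union a :|: complete_union b.
  by rewrite -(lift_union2 (@complete_union n.+1 j) ab) -ee.
by rewrite ua ub finset.setUACA finset.setUid.
Qed.

(** The node c is the centre of e. The margin over D_e is thus a node margin one tree lower, whose
    finiteness is known. *)
Lemma vine_conditioning_node j e : (j.+1 < n)%N -> e \in edges (V j.+1) ->
  exists2 c, c \in nodes (V j) & @conditioning_set n.+1 j.+1 e = complete_union c.
Proof.
move=> jn eE; have [hA cE _ _] := vine_invariant hV (ltnW jn).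
have Tj := vine_tree hV (ltnW jn); have Tj1 := vine_tree hV jn.
have nodes' := vine_nodes hV jn; have prox a b := @vine_proximity _ _ hV j a b jn.
have E1 : (1 < #|edges (V j)|)%N by rewrite cE; lia.
have [c cN cP] := common_endP Tj Tj1 nodes' prox eE; exists c => //.
rewrite -(bigcap_lift_union Tj Tj1 nodes' prox E1 hA eE (c := c)) //.
by rewrite cP eqxx.
Qed.

Lemma vine_first_edge e : (0 < n)%N -> e \in edges (V 0%N) ->
  @complete_union n.+1 1 e = [set @cond_fst n 0 e; @cond_snd n 0 e].
Proof.
move=> n0 eE; have [pq _ _ _] := vine_edge_shape hV n0 eE.
have [_ _ _ /(_ e eE) cU] := vine_invariant hV n0.
apply/esym/eqP; rewrite eqEcard vine_edge_union // finset.subsetUl /=.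
by rewrite -vine_edge_union // cU cards2 pq.
Qed.

(** [V n.-1] has n - (n - 1) = 1 edge, and its complete union has n + 1 elements. *)
Lemma vine_top_edge : (0 < n)%N -> exists2 e, edges (V n.-1) = [set e] &
  @complete_union n.+1 n.-1.+1 e = [set: 'I_n.+1].
Proof.
move=> n0; have top : (n.-1 < n)%N by rewrite prednK.
have [_ cE _ cU] := vine_invariant hV top.
have /eqP/cards1P[e Ee] : #|edges (V n.-1)| = 1%N by rewrite cE; lia.
have eE : e \in edges (V n.-1) by rewrite Ee finset.in_set1.
exists e => //; apply/eqP; rewrite eqEcard finset.subsetT cardsT card_ord.
by rewrite [leqRHS](cU e eE) /=; lia.
Qed.

End VineEdges.

(** * Telescoping of the node margins along the vine *)

Section VineTelescope.
Local Open Scope set_scope.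
Variables (n : nat) (V : forall j, graph (vnode n.+1 j)).
Hypothesis hV : regular_vine V.

Lemma prod_degree (F : comNzRingType) (T : finType) (G : graph T) (f : T -> F) :
  is_tree G ->
  \prod_(v in nodes G) f v ^+ degree G v = \prod_(e in edges G) \prod_(v in e) f v.
Proof.
move=> hG; under eq_bigr do rewrite -prodrXr.
rewrite exchange_big; apply: eq_bigr => e eE /=.
rewrite [LHS]big_mkcond [RHS]big_mkcond; apply: eq_bigr => v _ /=.
case: (boolP (v \in e)) => [ve|_]; last by case: ifP.
by rewrite (edge_nodes hG eE ve) expr1.
Qed.

Lemma prod_center_degree (F : comNzRingType) (T : finType) (G : graph T)
    (G' : graph {set T}) (f : T -> F) :
  \prod_(v in nodes G) f v ^+ center_degree G' v =
  \prod_(e in edges G') \prod_(v in nodes G | common_end e v) f v.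
Proof.
under eq_bigr do rewrite -prodrXr.
rewrite exchange_big; apply: eq_bigr => e eE /=.
rewrite [RHS]big_mkcondr; apply: eq_bigr => v _ /=.
by case: common_end.
Qed.

Variables (F : fieldType) (m : {set 'I_n.+1} -> F).
Hypothesis m1 : forall i, m [set i] = 1.
Hypothesis m0 : forall j, (j < n)%N -> forall e, e \in edges (V j) ->
  m (@complete_union n.+1 j.+1 e) != 0.

Let cu j (v : vnode n.+1 j) := m (complete_union v).

(** The value of the partial product up to level j: edge margins divided by node margins to the
    power degree minus one. *)
Let W j := (\prod_(e in edges (V j)) @cu j.+1 e) * (\prod_(v in nodes (V j)) cu v) /
  \prod_(v in nodes (V j)) cu v ^+ degree (V j) v.

Lemma vine_margin_neq0 j v : (j < n)%N -> v \in nodes (V j) -> cu v != 0.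
Proof.
case: j v => [|j] v jn; first by rewrite /cu /= m1 oner_neq0.
by rewrite (vine_nodes hV jn); apply: m0; apply: ltnW.
Qed.

(** The factors m D_e multiply to the node margins of [V j] to the power [center_degree], which is
    the degree minus one; the denominators multiply to the node margins of [V j.+1] to the power of
    their degrees. *)
Lemma vine_step j : (j.+1 < n)%N -> W j.+1 = W j * \prod_(e in edges (V j.+1))
  (@cu j.+2 e * m (@conditioning_set n.+1 j.+1 e) /
   \prod_(a in (e : {set vnode n.+1 j.+1})) cu a).
Proof.
move=> jn; have [hA cE _ _] := vine_invariant hV (ltnW jn).
have Tj := vine_tree hV (ltnW jn); have Tj1 := vine_tree hV jn.
have nodes' := vine_nodes hV jn; have prox a b := @vine_proximity _ _ hV j a b jn.
have E1 : (1 < #|edges (V j)|)%N by rewrite cE; lia.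
have cond : \prod_(e in edges (V j.+1)) m (@conditioning_set n.+1 j.+1 e) =
    \prod_(v in nodes (V j)) cu v ^+ center_degree (V j.+1) v.
  rewrite prod_center_degree; apply: eq_bigr => e eE.
  have [c cN cP] := common_endP Tj Tj1 nodes' prox eE.
  rewrite (big_pred1 c) => [|v /=]; last first.
    by rewrite cP; case: eqP => [->|]; rewrite ?cN ?andbF.
  rewrite /cu -(bigcap_lift_union Tj Tj1 nodes' prox E1 hA eE (c := c)) //.
  by rewrite cP eqxx.
have degS : \prod_(v in nodes (V j)) cu v ^+ degree (V j) v =
    (\prod_(v in nodes (V j)) cu v) * \prod_(v in nodes (V j)) cu v ^+ center_degree (V j.+1) v.
  rewrite -big_split; apply: eq_bigr => v vN.
  by rewrite (degree_center Tj Tj1 nodes' prox E1) // exprS.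
have P0 : \prod_(v in nodes (V j)) cu v != 0.
  by apply/prodf_neq0 => v; apply: vine_margin_neq0; apply: ltnW.
have C0 : \prod_(v in nodes (V j)) cu v ^+ center_degree (V j.+1) v != 0.
  by apply/prodf_neq0 => v vN; apply: expf_neq0; apply: vine_margin_neq0 vN; apply: ltnW.
rewrite /W degS prod_degree // prodf_div big_split /= cond nodes'.
set A := \prod_(e in edges (V j.+1)) _; set B := \prod_(e in edges (V j)) _.
set Q := \prod_(e in edges (V j.+1)) _.
move: A B Q => A B Q.
rewrite invfM; move: Q^-1 => {}Q.
by field; rewrite P0 C0.
Qed.

Lemma vine_telescope : (0 < n)%N -> m [set: 'I_n.+1] =
  (\prod_(e in edges (V 0%N)) @cu 1 e) *
  \prod_(1 <= j < n) \prod_(e in edges (V j))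
    (@cu j.+1 e * m (@conditioning_set n.+1 j e) /
     \prod_(a in (e : {set vnode n.+1 j})) cu a).
Proof.
move=> n0.
have N0 : nodes (V 0%N) = [set: 'I_n.+1] by case: hV.
have WE k : (k < n)%N -> W k = (\prod_(e in edges (V 0%N)) @cu 1 e) *
    \prod_(1 <= j < k.+1) \prod_(e in edges (V j))
    (@cu j.+1 e * m (@conditioning_set n.+1 j e) /
     \prod_(a in (e : {set vnode n.+1 j})) cu a).
  elim: k => [|k IH] kn.
    rewrite big_geq // mulr1 /W.
    rewrite [X in _ * X / _]big1 ?[X in _ / X]big1 ?mulr1 ?divr1 // => v _;
      by rewrite /cu /= m1 ?expr1n.
  by rewrite vine_step // IH ?(ltnW kn) // [in RHS]big_nat_recr //= mulrA.
have top : (n.-1 < n)%N by rewrite prednK.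
rewrite -[X in \prod_(1 <= j < X) _](prednK n0) -WE // /W.
have Tn := vine_tree hV top; have [_ cE _ _] := vine_invariant hV top.
have [e Ee eT] := vine_top_edge hV n0.
have eE : e \in edges (V n.-1) by rewrite Ee finset.in_set1.
have e2 := edge_card Tn eE.
have N1 : nodes (V n.-1) = e.
  apply/esym/eqP; rewrite eqEcard e2 (tree_card Tn) ?cE; last first.
    have /card_gt0P[v ve] : (0 < #|e|)%N by rewrite e2.
    by apply/set0Pn; exists v; apply: edge_nodes Tn _ _ eE ve.
  apply/andP; split; last by lia.
  by apply/fintype.subsetP => v; apply: edge_nodes Tn _ _ eE.
(* The top tree is one edge with its two ends, so the degrees are 1 and [W n.-1] reduces to m of the
   whole set. *)
have -> : \prod_(v in nodes (V n.-1)) cu v ^+ degree (V n.-1) v =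
    \prod_(v in nodes (V n.-1)) cu v.
  by rewrite prod_degree // Ee big_set1 N1.
rewrite -mulrA divff ?mulr1; last first.
  by apply/prodf_neq0 => v; apply: vine_margin_neq0.
by rewrite Ee big_set1 /cu eT.
Qed.
End VineTelescope.

(** * Lower semicontinuous functions on the orthant *)

Section Coordinates.
Context {R : realType} {d : nat}.
Implicit Types (x y : 'rV[R]_d) (i j : 'I_d) (s t : R).

Lemma updE x i t k : upd x i t 0 k = if k == i then t else x 0 k.
Proof. by rewrite mxE. Qed.

Lemma upd_id x i : upd x i (x 0 i) = x.
Proof. by apply/rowP => k; rewrite updE; case: eqP => [->|]. Qed.

Lemma upd_upd x i s t : upd (upd x i s) i t = upd x i t.
Proof. by apply/rowP => k; rewrite !updE; case: eqP. Qed.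

Lemma upd_comm x i j s t : i != j -> upd (upd x i s) j t = upd (upd x j t) i s.
Proof.
move=> ij; apply/rowP => k; rewrite !updE; case: (eqVneq k j) => // ->.
by rewrite eq_sym (negbTE ij).
Qed.

Lemma orthant_upd x i t : orthant x -> 0 < t -> orthant (upd x i t).
Proof. by move=> xp tp k; rewrite updE; case: eqP. Qed.

End Coordinates.

Section Semicontinuity.
Context {R : realType} {d : nat}.
Local Open Scope classical_set_scope.
Implicit Types (f : 'rV[R]_d -> \bar R) (x y : 'rV[R]_d) (i j : 'I_d).

Local Notation D := (`]0%R, +oo[ : set R).

Definition ge0_orthant f := forall x, orthant x -> (0 <= f x)%E.

(** Lower semicontinuity relative to the orthant, with balls of the sup norm; real levels c suffice,
    also where f is +oo. *)
Definition lsc_orthant f := forall x (c : R), orthant x -> (c%:E < f x)%E ->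
  exists2 e : R, 0 < e &
    forall y, orthant y -> (forall i, `|x 0 i - y 0 i| < e) -> (c%:E < f y)%E.

Lemma measurable_fun_superlevel dT (T : measurableType dT) (E : set T) (h : T -> \bar R) :
  (forall c : R, measurable (E `&` [set t | c%:E < h t]%E)) -> measurable_fun E h.
Proof.
move=> mh; apply: (measurability _ (ErealGenOInfty.measurableE R)).
by move=> /= _ [_ [a ->]] <-; rewrite preimage_itvoy.
Qed.

Definition lsc_halfline (h : R -> \bar R) := forall t (c : R), 0 < t -> (c%:E < h t)%E ->
  exists2 e : R, 0 < e & forall s, 0 < s -> `|t - s| < e -> (c%:E < h s)%E.

Lemma measurable_halfline (h : R -> \bar R) : lsc_halfline h -> measurable_fun D h.
Proof.
move=> hl; apply: measurable_fun_superlevel => c; apply: open_measurable.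
rewrite openE => t [/=]; rewrite in_itv /= andbT => t0 /(hl t c t0)[e e0 he].
exists (Num.min e t); first by rewrite /= lt_min e0 t0.
move=> s /=; rewrite lt_min => /andP[se st].
have s0 : 0 < s by move: st; rewrite ltr_norml; lra.
by split; [rewrite /= in_itv /= s0|exact: he].
Qed.

Lemma lsc_orthant_slice f x i : lsc_orthant f -> orthant x ->
  lsc_halfline (fun t => f (upd x i t)).
Proof.
move=> lf xp t c t0 /(lf _ _ (orthant_upd i xp t0))[e e0 he].
exists e => // s s0 ts; apply: he; first exact: orthant_upd.
by move=> k; rewrite !updE; case: eqP => // _; rewrite subrr normr0.
Qed.

Lemma measurable_slice f x i : lsc_orthant f -> orthant x ->
  measurable_fun D (fun t => f (upd x i t)).
Proof. by move=> lf xp; apply: measurable_halfline; apply: lsc_orthant_slice. Qed.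

Lemma ereal_le_real (u v : \bar R) : (0 <= v)%E ->
  (forall a : R, (a%:E < u)%E -> (a%:E <= v)%E) -> (u <= v)%E.
Proof.
case: v => [v| |] // v0 h; last by rewrite leey.
rewrite leNgt; apply/negP; case: u h => [u| |] // h uv.
  have := h ((u + v) / 2); rewrite !lte_fin !lee_fin in uv * => /(_ _).
  by move=> H; have := H ltac:(lra); lra.
by have := h (v + 1) (ltry _); rewrite lee_fin; lra.
Qed.

(** If this failed at x, the integrals would stay at most c along some points y_k tending to x; by
    Fatou's lemma and semicontinuity of f, the integral at x would be at most c too. *)
Lemma lsc_orthant_int f i : ge0_orthant f -> lsc_orthant f ->
  lsc_orthant (fun x => \int[lebesgue_measure]_(t in D) f (upd x i t))%E.
Proof.
move=> f0 lf x c xp cx; apply: contrapT => /forall2NP noe.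
have /choice[y yP] : forall k : nat, exists y : 'rV[R]_d, [/\ orthant y,
    forall i, `|x 0 i - y 0 i| < k.+1%:R^-1 &
    (\int[lebesgue_measure]_(t in D) f (upd y i t) <= c%:E)%E].
  move=> k; have [|] := noe k.+1%:R^-1; first by rewrite invr_gt0 ltr0n.
  move=> /existsNP[y] /not_implyP[yp] /not_implyP[xy] /negP; rewrite -leNgt => yc.
  by exists y.
have inD t : D t -> 0 < t by rewrite /= in_itv /= andbT.
have mfy k : measurable_fun D (fun t => f (upd (y k) i t)).
  by apply: measurable_slice => //; case: (yP k).
have f0y k t : D t -> (0 <= f (upd (y k) i t))%E.
  by move=> /inD t0; apply/f0/orthant_upd => //; case: (yP k).
have := fatou lebesgue_measure (measurable_itv _) mfy f0y.
apply/negP; rewrite -ltNge.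
apply: (@le_lt_trans _ _ c%:E).
  rewrite limn_einf_lim; apply: lime_le; first exact: is_cvg_einfs.
  apply: nearW => k; apply: le_trans (_ : \int[lebesgue_measure]_(t in D) f (upd (y k) i t) <= _)%E.
    by apply: ereal_inf_lbound; exists k => /=.
  by case: (yP k).
have mE : measurable_fun D (fun t => limn_einf (fun k => f (upd (y k) i t))).
  have mN k : measurable_fun D (fun t => - f (upd (y k) i t))%E.
    by apply: measurableT_comp (mfy k); exact: oppe_measurable.
  have mS : measurable_fun D (fun t => limn_esup (fun k => - f (upd (y k) i t)))%E.
    exact: (measurable_fun_limn_esup mN).
  by apply: measurableT_comp mS; exact: oppe_measurable.
apply: (lt_le_trans cx); apply: ge0_le_integral => //.
- by move=> t /inD t0; apply/f0/orthant_upd.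
- exact: measurable_slice.
(* Pointwise, f at [upd x i t] is at most the lower limit along y_k; this is tested against every
   real a below the left side. *)
move=> t Dt; have t0 := inD _ Dt; apply: ereal_le_real.
  rewrite limn_einf_lim; apply: lime_ge; first exact: is_cvg_einfs.
  by apply: nearW => k; apply: le_ereal_inf_tmp => _ [m _ <-]; apply: f0y.
move=> a /(lf _ _ (orthant_upd i xp t0))[e e0 he].
rewrite limn_einf_lim; apply: lime_ge; first exact: is_cvg_einfs.
have [N _ Ne] := near_infty_natSinv_lt (PosNum e0).
exists N => // k /= Nk; apply: le_ereal_inf_tmp => _ [m /= km <-]; apply/ltW/he.
  by apply: orthant_upd => //; case: (yP m).
have [_ xym _] := yP m.
move=> l; rewrite !updE; case: eqP => _; first by rewrite subrr normr0.
apply: lt_trans (xym l) _; apply: Ne; exact: leq_trans Nk km.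
Qed.

Lemma ge0_orthant_int f i : ge0_orthant f ->
  ge0_orthant (fun x => \int[lebesgue_measure]_(t in D) f (upd x i t))%E.
Proof.
move=> f0 x xp; apply: integral_ge0 => t; rewrite /= in_itv /= andbT => t0.
exact/f0/orthant_upd.
Qed.
End Semicontinuity.

(** * Tonelli's theorem for iterated integrals over coordinates *)

Section Tonelli.
Context {R : realType} {d : nat}.
Local Open Scope classical_set_scope.
Implicit Types (f : 'rV[R]_d -> \bar R) (x y : 'rV[R]_d) (i j : 'I_d).

Local Notation D := (`]0%R, +oo[ : set R).

(** Such a set is open, hence a union of products of two balls with rational centres and radius
    1/(k+1), of which there are countably many. *)
Lemma open_measurable_prod (U : set (R * R)) :
  (forall p, U p -> exists2 e : R, 0 < e &
     forall q, `|p.1 - q.1| < e -> `|p.2 - q.2| < e -> U q) ->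
  measurable (U : set (R * R)%type).
Proof.
move=> Uo.
pose box (q : rat * rat) (k : nat) : set (R * R) :=
  ball (ratr q.1 : R) k.+1%:R^-1 `*` ball (ratr q.2 : R) k.+1%:R^-1.
have -> : U = \bigcup_(m in [set m : rat * rat * nat | box m.1 m.2 `<=` U]) box m.1 m.2.
  apply/seteqP; split=> [p Up|p [m]]; last by move=> /= mU /mU.
  have [e e0 pe] := Uo _ Up.
  (* A radius below e / 2 keeps the box within e of p, as its centre is itself within that radius of
     p. *)
  have [N _ Ne] := near_infty_natSinv_lt (PosNum (divr_gt0 e0 (ltr0n _ 2))).
  have Ne' := Ne N (leqnn N) : (N.+1%:R^-1 < e / 2)%R.
  set w := N.+1%:R^-1 in Ne'.
  have w0 : 0 < w :> R by rewrite invr_gt0.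
  have rat_near (s : R) : exists q : rat, `|ratr q - s| < w.
    have [|q] := @rat_in_itvoo R s (s + w); first by rewrite ltrDl.
    rewrite in_itv /= => /andP[sq qs]; exists q.
    by rewrite gtr0_norm ?subr_gt0 // ltrBlDl.
  have [q1 q1p] := rat_near p.1; have [q2 q2p] := rat_near p.2.
  exists ((q1, q2), N) => //= z [/= z1 z2].
  rewrite /ball /= in z1 z2; apply: pe.
    by move: q1p z1; rewrite !ltr_norml -/w => /andP[? ?] /andP[? ?]; apply/andP; split; lra.
  by move: q2p z2; rewrite !ltr_norml -/w => /andP[? ?] /andP[? ?]; apply/andP; split; lra.
rewrite bigcup_mkcond; apply: countable_bigcupT_measurable.
  exact: (@countableP (rat * rat * nat)%type).
move=> m; case: ifP => _; last exact: measurable0.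
by apply: measurableX; exact: measurable_ball.
Qed.

(** Extended by 0 outside the open quadrant Q, the integrand has superlevel sets that are open or
    the whole plane; it is therefore jointly measurable and Tonelli applies. *)
Lemma int_swap f i j x : ge0_orthant f -> lsc_orthant f -> orthant x -> i != j ->
  (\int[lebesgue_measure]_(s in D) \int[lebesgue_measure]_(t in D) f (upd (upd x i s) j t) =
   \int[lebesgue_measure]_(t in D) \int[lebesgue_measure]_(s in D) f (upd (upd x i s) j t))%E.
Proof.
move=> f0 lf xp ij.
pose Q : set (R * R) := [set p | 0 < p.1 /\ 0 < p.2].
pose g := (fun p : R * R => f (upd (upd x i p.1) j p.2)) \_ Q.
have gQ p : Q p -> g p = f (upd (upd x i p.1) j p.2) by move=> Qp; rewrite /g patchT // inE.
have gNQ p : ~ Q p -> g p = 0%E by move=> Qp; rewrite /g patchN // notin_setE.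
have oQ p : Q p -> orthant (upd (upd x i p.1) j p.2).
  by move=> [p1 p2]; do 2 apply: orthant_upd => //.
have g0 p : (0 <= g p)%E.
  by have [Qp|Qp] := pselect (Q p); [rewrite gQ //; apply/f0/oQ|rewrite gNQ].
have mg : measurable_fun setT g.
  apply: measurable_fun_superlevel => c; rewrite setTI.
  have [c0|c0] := ltP c 0.
    rewrite (_ : [set _ | _] = setT); first exact: measurableT.
    by apply/seteqP; split=> // p _; rewrite /= (lt_le_trans _ (g0 p)) // lte_fin.
  apply: open_measurable_prod => p /= cp.
  have Qp : Q p by apply: contrapT => /gNQ gp; move: cp; rewrite gp lte_fin ltNge c0.
  rewrite gQ // in cp; have [e e0 he] := lf _ _ (oQ _ Qp) cp.
  have [p1 p2] := Qp.
  exists (Num.min e (Num.min p.1 p.2)); first by rewrite !lt_min e0 p1 p2.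
  move=> q; rewrite !lt_min => /and3P[q1e q1p _] /and3P[q2e _ q2p].
  have Qq : Q q by move: q1p q2p; rewrite !ltr_norml => /andP[? ?] /andP[? ?]; split; lra.
  rewrite gQ //; apply: he; first exact: oQ.
  move=> k; rewrite !updE; case: eqP => // _; case: eqP => // _.
  by rewrite subrr normr0.
have inD t : (t \in D) = (0 < t) by rewrite mem_setE in_itv /= andbT.
have E1 : (\int[lebesgue_measure]_s \int[lebesgue_measure]_t g (s, t) =
  \int[lebesgue_measure]_(s in D) \int[lebesgue_measure]_(t in D) f (upd (upd x i s) j t))%E.
  rewrite [RHS]integral_mkcond; apply: eq_integral => s _; rewrite patchE inD.
  case: ifPn => s0.
    rewrite [RHS]integral_mkcond; apply: eq_integral => t _; rewrite patchE inD.
    by case: ifPn => t0; [rewrite gQ|rewrite gNQ // => -[_ /=]; apply/negP].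
  by rewrite integral0_eq // => t _; rewrite gNQ // => -[/= + _]; apply/negP.
have E2 : (\int[lebesgue_measure]_t \int[lebesgue_measure]_s g (s, t) =
  \int[lebesgue_measure]_(t in D) \int[lebesgue_measure]_(s in D) f (upd (upd x i s) j t))%E.
  rewrite [RHS]integral_mkcond; apply: eq_integral => t _; rewrite patchE inD.
  case: ifPn => t0.
    rewrite [RHS]integral_mkcond; apply: eq_integral => s _; rewrite patchE inD.
    by case: ifPn => s0; [rewrite gQ|rewrite gNQ // => -[/= + _]; apply/negP].
  by rewrite integral0_eq // => s _; rewrite gNQ // => -[_ /=]; apply/negP.
by rewrite -E1 -E2; exact: (@fubini_tonelli _ _ _ _ R lebesgue_measure lebesgue_measure g mg g0).
Qed.

Lemma int_coords_upd f s x i t : i \in s -> int_coords f s (upd x i t) = int_coords f s x.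
Proof.
elim: s x => //= k s IH x; rewrite inE => /predU1P[->|is_].
  by apply: eq_integral => u _; rewrite upd_upd.
apply: eq_integral => u _; have [->|ik] := eqVneq i k; first by rewrite upd_upd.
by rewrite upd_comm // IH.
Qed.

Lemma int_coords_ge0 f s : ge0_orthant f -> ge0_orthant (int_coords f s).
Proof. by move=> f0; elim: s => //= k s IH; apply: ge0_orthant_int. Qed.

Lemma int_coords_lsc f s : ge0_orthant f -> lsc_orthant f -> lsc_orthant (int_coords f s).
Proof.
move=> f0 lf; elim: s => //= k s IH; apply: lsc_orthant_int => //.
exact: int_coords_ge0.
Qed.

Lemma eq_int_orthant f g x i : orthant x -> (forall y, orthant y -> f y = g y) ->
  (\int[lebesgue_measure]_(t in D) f (upd x i t) =
   \int[lebesgue_measure]_(t in D) g (upd x i t))%E.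
Proof.
move=> xp fg; apply: eq_integral => t; rewrite inE /= in_itv /= andbT => t0.
exact/fg/orthant_upd.
Qed.

Lemma int_coords_swap f i j s x : ge0_orthant f -> lsc_orthant f -> orthant x ->
  int_coords f (i :: j :: s) x = int_coords f (j :: i :: s) x.
Proof.
move=> f0 lf xp; have [->//|ij] := eqVneq i j.
have h := int_swap (@int_coords_ge0 f s f0) (@int_coords_lsc f s f0 lf) xp ij.
rewrite /=; apply: (etrans h).
apply: eq_integral => u _; apply: eq_integral => t _.
by rewrite (upd_comm _ _ _ ij).
Qed.

Lemma int_coords_perm f s1 s2 x : ge0_orthant f -> lsc_orthant f -> orthant x ->
  perm_eq s1 s2 -> int_coords f s1 x = int_coords f s2 x.
Proof.
move=> f0 lf; elim: s1 s2 x => [|a s1 IH] s2 x xp.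
  by rewrite perm_sym => /perm_nilP->.
move=> s12; have : a \in s2 by rewrite -(perm_mem s12) mem_head.
move=> /path.splitPr s2E; case: s2E s12 => t1 t2 s12.
have s1t : perm_eq s1 (t1 ++ t2).
  by rewrite -(perm_cons a) (perm_trans s12) // -[a :: t2]cat1s perm_catCA.
rewrite /= (eq_int_orthant a xp (fun y yp => IH (t1 ++ t2) y yp s1t)).
rewrite -[LHS]/(int_coords f (a :: t1 ++ t2) x).
(* It remains to move a past [t1] by exchanging neighbouring integrations. *)
elim: t1 x xp {s12 s1t IH} => //= b t1 IH x xp.
rewrite -[LHS]/(int_coords f (a :: b :: t1 ++ t2) x) int_coords_swap //.
exact: (eq_int_orthant b xp (fun y yp => IH y yp)).
Qed.

End Tonelli.

(** * Distribution functions and quantiles on the half-line *)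

Section HalfLine.
Context {R : realType}.
Local Open Scope classical_set_scope.
Local Notation D := (`]0%R, +oo[ : set R).
Variable h : R -> \bar R.

Hypothesis h0 : forall t, 0 < t -> (0 <= h t)%E.
Hypothesis hlsc : lsc_halfline h.

Let inD t : D t -> 0 < t. Proof. by rewrite /= in_itv /= andbT. Qed.

Let mh : measurable_fun D h. Proof. exact: measurable_halfline. Qed.

(** By semicontinuity h exceeds some c > 0 near u; as u may be an end of the interval, only a
    one-sided neighbourhood of u may lie in A. *)
Lemma halfline_int_gt0 (A : set R) u a b : measurable A -> A `<=` D ->
  0 < u -> (0 < h u)%E -> a < b -> a <= u <= b -> `]a, b[ `<=` A ->
  (0 < \int[lebesgue_measure]_(s in A) h s)%E.
Proof.
move=> mA AD u0 hu ab /andP[au ub] abA.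
have [c c0 cu] : exists2 c : R, 0 < c & (c%:E < h u)%E.
  case: (h u) hu => [z| |] //.
    by rewrite lte_fin => z0; exists (z / 2); rewrite ?lte_fin; lra.
  by exists 1; rewrite ?ltry.
have [e e0 he] := hlsc u0 cu.
pose a' := Num.max a (u - e); pose b' := Num.min b (u + e).
have ab' : a' < b' by rewrite gt_max !lt_min; apply/andP; split; apply/andP; split; lra.
have sub : `]a', b'[ `<=` A.
  apply: subset_trans abA; apply: subset_itv; rewrite bnd_simp.
    by rewrite le_max lexx.
  by rewrite ge_min lexx.
apply: (@lt_le_trans _ _ (\int[lebesgue_measure]_(s in `]a', b'[) cst c%:E s)%E).
  rewrite integral_cst //= lebesgue_measure_itv /= lte_fin ab' -EFinD -EFinM lte_fin.
  by rewrite mulr_gt0 // subr_gt0.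
apply: (@le_trans _ _ (\int[lebesgue_measure]_(s in `]a', b'[) h s)%E).
  apply: ge0_le_integral => //.
  - by move=> s _; rewrite lee_fin ltW.
  - by apply: measurable_funS mh => //; apply: subset_trans sub AD.
  - move=> s sab; have s0 : 0 < s by apply/inD/AD/sub.
    move: sab; rewrite /= in_itv /= gt_max lt_min => /andP[/andP[_ s1] /andP[_ s2]].
    by apply/ltW/he => //; rewrite ltr_norml; apply/andP; split; lra.
apply: ge0_subset_integral => //.
  exact: measurable_funS mh.
by move=> s As; apply/h0/inD/AD.
Qed.

Variable M : R.
Hypothesis hM : (\int[lebesgue_measure]_(s in D) h s = M%:E)%E.

Let k s := fine (h s).
Definition halfline_cdf t := \int[lebesgue_measure]_(s in `]0, t]) k s.
Local Notation G := halfline_cdf.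

Let inth : lebesgue_measure.-integrable D h.
Proof.
apply/integrableP; split; first exact: mh.
rewrite [X in (X < _)%E](_ : _ = M%:E) ?ltry // -hM; apply: eq_integral => s.
by rewrite inE => /inD s0; rewrite gee0_abs // h0.
Qed.

Let mk : measurable_fun D k. Proof. exact: measurableT_comp mh. Qed.

Lemma integrable_fine_halfline : lebesgue_measure.-integrable D (EFin \o k).
Proof.
apply: le_integrable inth => //; first exact/measurable_EFinP.
move=> s /inD s0; have ks : (0 <= (k s)%:E)%E by rewrite lee_fin fine_ge0 // h0.
rewrite -[(EFin \o k) s]/((k s)%:E) (gee0_abs ks) (gee0_abs (h0 s0)) /k.
by case: (h s) (h0 s0) => [z| |] //= _; rewrite leey.
Qed.

Let sub_D a b : 0 <= a -> `]a, b] `<=` D.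
Proof. by move=> a0 s; rewrite /= !in_itv /= andbT => /andP[/(le_lt_trans a0)]. Qed.

(** An integrable h is finite almost everywhere, so replacing +oo by 0 does not change its
    integrals. *)
Lemma Rintegral_fine_halfline (A : set R) : measurable A -> A `<=` D ->
  (\int[lebesgue_measure]_(s in A) k s)%:E = (\int[lebesgue_measure]_(s in A) h s)%E.
Proof.
move=> mA AD.
have intAk : lebesgue_measure.-integrable A (EFin \o k).
  exact: integrableS integrable_fine_halfline.
rewrite /Rintegral fineK; last exact: integrable_fin_num.
apply: ge0_ae_eq_integral => //.
- by apply/measurable_EFinP; apply: measurable_funS mk.
- exact: measurable_funS mh.
- by move=> s /AD/inD s0; rewrite lee_fin fine_ge0 // h0.
- by move=> s /AD/inD s0; rewrite h0.
have : {ae lebesgue_measure, forall s, A s -> h s \is a fin_num}.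
  by apply: integrable_ae => //; apply: integrableS inth.
move=> [N [mN N0 sub]]; exists N; split=> // s /= ns; apply: sub => /= hs.
by apply: ns => As; rewrite fineK // hs.
Qed.

Lemma halfline_cdfB s t : 0 <= s -> s <= t ->
  G t - G s = \int[lebesgue_measure]_(u in `]s, t]) k u.
Proof.
move=> s0 st; apply: Rintegral_itvB; rewrite ?bnd_simp //.
by apply: integrableS integrable_fine_halfline => //; apply: sub_D.
Qed.

Lemma halfline_cdf_le s t : 0 <= s -> s <= t -> G s <= G t.
Proof.
move=> s0 st; rewrite -subr_ge0 halfline_cdfB //; apply: Rintegral_ge0 => u ust.
by apply/fine_ge0/h0/inD/(sub_D s0 ust).
Qed.

Lemma halfline_cdf_lt s t u : 0 <= s -> s < t -> s <= u <= t -> 0 < u -> (0 < h u)%E ->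
  G s < G t.
Proof.
move=> s0 st sut u0 hu; rewrite -subr_gt0 halfline_cdfB // ?ltW //.
rewrite -lte_fin Rintegral_fine_halfline //; last exact: sub_D.
apply: (halfline_int_gt0 (u := u) (a := s) (b := t)) => //.
  exact: sub_D.
by apply: subset_itvl; rewrite bnd_simp.
Qed.

Lemma halfline_cdf0 : G 0 = 0.
Proof. by rewrite /halfline_cdf set_itv_ge ?Rintegral_set0 // bnd_simp ltxx. Qed.

Lemma halfline_cdf_le_total t : G t <= M.
Proof.
rewrite -lee_fin Rintegral_fine_halfline //; last exact: sub_D.
rewrite -hM; apply: ge0_subset_integral => //; last exact: sub_D.
by move=> s /inD /h0.
Qed.

Lemma halfline_cdf_bounds x : 0 < x -> (0 < h x)%E -> 0 < G x < M.
Proof.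
move=> x0 hx; apply/andP; split.
  rewrite -halfline_cdf0; apply: (halfline_cdf_lt (u := x)) => //.
  by rewrite lexx /= ltW.
apply: lt_le_trans (halfline_cdf_le_total (x + 1)).
apply: (halfline_cdf_lt (u := x)) => //; [exact: ltW|by rewrite ltrDl|].
by rewrite lexx /= lerDl ler01.
Qed.

Local Notation Q x := [set t | 0 < t /\ G x <= G t].

(** Every t < x has G t < G x, because h is positive at x and hence just to the left of it. *)
Lemma halfline_quantile x : 0 < x -> (0 < h x)%E -> inf (Q x) = x.
Proof.
move=> x0 hx; have Qx : Q x x by [].
have lb : lbound (Q x) x.
  move=> t [t0 xt]; rewrite leNgt; apply/negP => tx; move: xt; rewrite leNgt => /negP; apply.
  by apply: (halfline_cdf_lt (u := x)) => //; [exact: ltW|rewrite lexx ltW].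
apply/eqP; rewrite eq_le; apply/andP; split; first by apply: ge_inf => //; exists x.
by apply: lb_le_inf => //; exists x.
Qed.

(* By right continuity the cdf takes the value G x at the quantile y < x, so h
   vanishes almost everywhere on ]y, x], hence at y by lower semicontinuity. *)
Lemma halfline_quantile_neq x : 0 < x -> 0 < G x -> inf (Q x) != x ->
  0 < inf (Q x) /\ h (inf (Q x)) = 0%E.
Proof.
move=> x0 Gx yx; set y := inf (Q x) in yx *.
have Qx : Q x x by [].
have lb : has_lbound (Q x) by exists 0 => t [/ltW].
have {}yx : y < x by rewrite lt_neqAle yx; apply: ge_inf.
have y0 : 0 <= y by apply: lb_le_inf; [exact: (ex_intro _ x Qx)|move=> t [/ltW]].
have Gt t : y < t -> G x <= G t.
  move=> yt; have [||s [s0 xs] st] := @inf_adherent R (Q x) (t - y).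
  - by rewrite subr_gt0.
  - exact: (conj (ex_intro _ x Qx) lb).
  apply: (le_trans xs); apply: halfline_cdf_le; first exact: ltW.
  by move: st; rewrite -/y addrC subrK => /ltW.
have Gy : G x <= G y.
  rewrite leNgt; apply/negP => lt; have e0 : 0 < G x - G y by rewrite subr_gt0.
  (* The continuity of the integral is used on the closed interval from y to x, and y may still be
     0; hence the extension of [k] by 0. *)
  pose k0 := k \_ D.
  have intk0 a b : lebesgue_measure.-integrable `[a, b] (EFin \o k0).
    have : lebesgue_measure.-integrable setT (EFin \o k0).
      by rewrite -restrict_EFin; apply/integrable_restrict => //; rewrite setTI;
        exact: integrable_fine_halfline.
    exact: integrableS.
  have /nbhs_ballP[e /= ep he] := parameterized_integral_near_left yx e0 (intk0 y x).
  (* At c, to the right of y, the cdf has grown by less than G x - G y, against [Gt]. *)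
  pose c := y + e / 2.
  have yc : y < c by rewrite ltrDl; lra.
  have := he c; rewrite /ball /= => /(_ _)/(_ _).
  have -> : parameterized_integral lebesgue_measure y c k0 = G c - G y.
    rewrite /parameterized_integral -Rintegral_itv_obnd_cbnd; last first.
      by apply: integrableS (intk0 y c) => //; apply: subset_itvr; rewrite bnd_simp.
    rewrite halfline_cdfB // ?ltW //; apply: eq_Rintegral => s; rewrite inE => syc.
    by rewrite /k0 patchT // inE; apply: sub_D y0 _ syc.
  have -> : `|y - c| < e by rewrite distrC gtr0_norm; rewrite /c; lra.
  move=> /(_ isT (ltW yc)); have := Gt c yc; have := ler_norm (G c - G y); lra.
have yp : 0 < y.
  by rewrite lt_neqAle y0 andbT; apply/eqP => yE; move: Gy; rewrite -yE halfline_cdf0; lra.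
split=> //; apply/eqP; rewrite eq_le h0 // andbT leNgt; apply/negP => hy.
have := halfline_cdf_lt y0 yx (_ : y <= y <= x) yp hy.
by rewrite lexx (ltW yx) => /(_ isT); lra.
Qed.

End HalfLine.

(** * Margins and conditional distributions *)

Section Margins.
Context {R : realType} {d : nat}.
Local Open Scope classical_set_scope.
Local Notation D0 := (`]0%R, +oo[ : set R).
Variables (r : 'rV[R]_d -> R) (hr : tail_copula_density r).
Implicit Types (x : 'rV[R]_d) (J D : {set 'I_d}) (a b i : 'I_d).

Lemma density_ge0 : ge0_orthant (EFin \o r).
Proof. by move=> x xp; rewrite lee_fin; case: hr => _ h _ _; apply: h. Qed.

Lemma density_lsc : lsc_orthant (EFin \o r).
Proof.
move=> x c xp; rewrite lte_fin => cx; case: hr => h _ _ _.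
have /(_ x) := h; rewrite inE => /(_ xp) /(cvgr_gt (r x)) /(_ c cx) /nbhs_ballP[e /= e0 he].
exists e => // y yp xy; rewrite lte_fin; apply: he.
by split=> // i j; rewrite (ord1 i); apply: xy.
Qed.

Lemma emargin_ge0 J : ge0_orthant (emargin r J).
Proof. exact: int_coords_ge0 density_ge0. Qed.

Lemma emargin_lsc J : lsc_orthant (emargin r J).
Proof. exact: int_coords_lsc density_ge0 density_lsc. Qed.

Lemma emargin_upd J x i t : i \notin J -> emargin r J (upd x i t) = emargin r J x.
Proof. by move=> iJ; apply: int_coords_upd; rewrite mem_enum finset.inE. Qed.

Lemma emargin_int J x a : orthant x -> a \notin J -> emargin r J x =
  (\int[lebesgue_measure]_(t in D0) emargin r (a |: J)%SET (upd x a t))%E.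
Proof.
move=> xp aJ; rewrite -[RHS]/(int_coords _ (a :: enum (~: (a |: J))%SET) x).
apply: int_coords_perm => //; [exact: density_ge0|exact: density_lsc|].
apply: uniq_perm; rewrite ?enum_uniq //= ?mem_enum ?finset.inE ?eqxx ?enum_uniq //.
move=> i; rewrite inE !mem_enum !finset.inE negb_or.
by case: eqVneq => // ->; rewrite aJ.
Qed.

Lemma emargin_setT x : emargin r [set: 'I_d]%SET x = (r x)%:E.
Proof. by rewrite /emargin finset.setCT enum_set0. Qed.

(** Each integration preserves positivity at x, since a lower semicontinuous slice that is positive
    at [x 0 k] is bounded below by a positive constant on an interval. *)
Lemma emargin_gt0 J x : orthant x -> 0 < r x -> (0 < emargin r J x)%E.
Proof.
move=> xp rx; rewrite /emargin; elim: (enum _) => [|k s IH] /=; first by rewrite lte_fin.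
apply: (@halfline_int_gt0 _ _ _ _ _ (x 0 k) 0 (x 0 k)) => //.
- by move=> t t0; apply: int_coords_ge0 (orthant_upd k xp t0); apply: density_ge0.
- by apply: lsc_orthant_slice xp; apply: int_coords_lsc; [exact: density_ge0|exact: density_lsc].
- by rewrite upd_id.
- by rewrite lexx ltW.
- by move=> t; rewrite /= !in_itv /= andbT => /andP[].
Qed.

Lemma margin_gt0 J x : orthant x -> 0 < r x -> (emargin r J x < +oo)%E -> 0 < margin r J x.
Proof. by move=> xp rx fin; apply: fine_gt0; rewrite emargin_gt0. Qed.

(** * Conditional distribution of one coordinate *)

Section Conditional.
Variables (a : 'I_d) (D : {set 'I_d}) (x : 'rV[R]_d).
Hypotheses (xp : orthant x) (aD : a \notin D) (Dfin : (emargin r D x < +oo)%E).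

Let h t := emargin r (a |: D)%SET (upd x a t).

Let h0 t : 0 < t -> (0 <= h t)%E.
Proof. by move=> t0; apply/emargin_ge0/orthant_upd. Qed.

Let hlsc : lsc_halfline h.
Proof. by apply: lsc_orthant_slice => //; apply: emargin_lsc. Qed.

Let hM : (\int[lebesgue_measure]_(t in D0) h t = (margin r D x)%:E)%E.
Proof.
rewrite -emargin_int // fineK // ge0_fin_numE //; exact: emargin_ge0.
Qed.

(** As a is not in D, the margin over D is constant along the slice and can be taken out of the
    integral. *)
Lemma cond_cdfE t : cond_cdf r a D t x = halfline_cdf h t / margin r D x.
Proof.
rewrite /halfline_cdf /cond_cdf -RintegralZr //; last first.
  apply: integrableS (integrable_fine_halfline h0 hlsc hM) => //.
  by move=> s; rewrite /= !in_itv /= andbT => /andP[].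
apply: eq_Rintegral => s _; rewrite /cond_density; congr (_ / _).
by rewrite /margin emargin_upd.
Qed.

Lemma cond_quantileE : 0 < margin r D x ->
  cond_quantile r a D (cond_cdf r a D (x 0 a) x) x =
  inf [set t | 0 < t /\ halfline_cdf h (x 0 a) <= halfline_cdf h t].
Proof.
move=> m0; rewrite /cond_quantile; congr inf; apply/seteqP.
by split=> t [t0] tQ; split=> //; move: tQ; rewrite !cond_cdfE ler_pM2r ?invr_gt0.
Qed.

Lemma cond_cdf_regular : 0 < margin r D x -> (0 < emargin r (a |: D)%SET x)%E ->
  0 < cond_cdf r a D (x 0 a) x < 1 /\
  cond_quantile r a D (cond_cdf r a D (x 0 a) x) x = x 0 a.
Proof.
move=> m0 aD0; have hx : (0 < h (x 0%R a))%E by rewrite /h upd_id.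
have qx := halfline_quantile h0 hlsc hM (xp a) hx.
rewrite cond_quantileE // cond_cdfE; split; last exact: qx.
have /andP[G0 GM] := halfline_cdf_bounds h0 hlsc hM (xp a) hx.
by rewrite divr_gt0 //= ltr_pdivrMr // mul1r.
Qed.

Lemma cond_quantile_neq : 0 < cond_cdf r a D (x 0 a) x ->
  let y := cond_quantile r a D (cond_cdf r a D (x 0 a) x) x in
  y != x 0 a -> margin r (a |: D)%SET (upd x a y) = 0.
Proof.
move=> u0 y yx.
(* Division by 0 yields 0, so a positive conditional distribution function excludes a zero margin
   over D. *)
have m0 : 0 < margin r D x.
  rewrite lt_neqAle fine_ge0 ?emargin_ge0 // andbT eq_sym.
  by apply: contraTneq u0 => m0; rewrite cond_cdfE m0 invr0 mulr0 ltxx.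
have G0 : 0 < halfline_cdf h (x 0 a).
  by move: u0; rewrite cond_cdfE pmulr_lgt0 // invr_gt0.
rewrite /y cond_quantileE // in yx *.
by have [_ hy] := halfline_quantile_neq h0 hlsc hM (xp a) G0 yx; rewrite /margin [emargin _ _ _]hy.
Qed.

End Conditional.

(** * Pair copula densities at the conditional distribution functions *)

Section PairCopula.
Variables (a b : 'I_d) (D : {set 'I_d}) (x : 'rV[R]_d).
Hypotheses (xp : orthant x) (ab : a != b) (aD : a \notin D) (bD : b \notin D).
Hypothesis Dfin : (emargin r D x < +oo)%E.

Let u := cond_cdf r a D (x 0 a) x.
Let v := cond_cdf r b D (x 0 b) x.

(** The quantiles give back x_a and x_b. The margin over D divides once in the numerator and twice
    in the denominator, and so remains as a factor. *)
Lemma pair_copula_density_gt0 : 0 < r x -> pair_copula_density r a b D u v x =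
  margin r ([set a; b] :|: D)%SET x * margin r D x /
  (margin r (a |: D)%SET x * margin r (b |: D)%SET x).
Proof.
move=> rx; have m0 := margin_gt0 xp rx Dfin.
have [ua qa] := cond_cdf_regular xp aD Dfin m0 (emargin_gt0 _ xp rx).
have [vb qb] := cond_cdf_regular xp bD Dfin m0 (emargin_gt0 _ xp rx).
rewrite /pair_copula_density ua vb /= qa upd_id qb upd_id /cond_density.
rewrite !invfM !invrK; move: (margin r D x) m0 => m m0.
move: (margin r (a |: D)%SET x)^-1 (margin r (b |: D)%SET x)^-1 => B C.
by field; rewrite gt_eqF.
Qed.

(** Outside the open unit square the value is 0 by definition. Inside it, either a quantile misses
    its coordinate and the denominator vanishes, where division by 0 gives 0, or both quantiles are
    exact and the numerator is a multiple of r(x). *)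
Lemma pair_copula_density_eq0 : r x = 0 -> ([set a; b] :|: D)%SET = [set: 'I_d]%SET ->
  pair_copula_density r a b D u v x = 0.
Proof.
move=> rx abD; rewrite /pair_copula_density; case: ifP => // /andP[/andP[u0 _] /andP[v0 _]].
have [qa|/(cond_quantile_neq xp aD Dfin u0) ma] :=
  eqVneq (cond_quantile r a D u x) (x 0 a); last first.
  have -> y : cond_density r [set a]%SET D (upd (upd x a (cond_quantile r a D u x)) b y) = 0.
    rewrite /cond_density /margin emargin_upd ?finset.in_setU1 ?negb_or 1?eq_sym ?ab //.
    by rewrite -/(margin _ _ _) ma mul0r.
  by rewrite mul0r invr0 mulr0.
have [qb|/(cond_quantile_neq xp bD Dfin v0) mb] :=
  eqVneq (cond_quantile r b D v x) (x 0 b); last first.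
  rewrite qa upd_id.
  have -> : cond_density r [set b]%SET D (upd x b (cond_quantile r b D v x)) = 0.
    by rewrite /cond_density mb mul0r.
  by rewrite mulr0 invr0 mulr0.
by rewrite qa upd_id qb upd_id /cond_density abD /margin emargin_setT rx !mul0r.
Qed.

End PairCopula.
End Margins.

(** Here d = n + 1 and [V j] is the tree T_{j+1}, so the levels 1 <= j < n run from T_2 to T_{d-1}.
    A margin can be infinite at some points, where [margin] takes the value 0; [hfin] asks for
    finiteness at x over the complete unions of edges. *)
Theorem theorem5p1 (R : realType) (n : nat) (hd : (3 <= n.+1)%N)
    (r : 'rV[R]_n.+1 -> R) (hr : tail_copula_density r)
    (V : forall j, graph (vnode n.+1 j)) (hV : regular_vine V)
    (x : 'rV[R]_n.+1) (hx : orthant x)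
    (hfin : forall j, (j < n)%N -> forall e, e \in edges (V j) ->
       (emargin r (@complete_union n.+1 j.+1 e) x < +oo)%E) :
  r x =
    (\prod_(e in edges (V 0%N))
        margin r [set @cond_fst n 0 e; @cond_snd n 0 e]%SET x) *
    \prod_(1 <= j < n) \prod_(e in edges (V j))
        (let a := @cond_fst n j e in
         let b := @cond_snd n j e in
         let D := @conditioning_set n.+1 j e in
         pair_copula_density r a b D
           (cond_cdf r a D (x 0 a) x) (cond_cdf r b D (x 0 b) x) x).
Proof.
have n0 : (0 < n)%N by lia.
have e1 i : emargin r [set i]%SET x = 1%E by case: hr => _ _ h _; apply: h.
have finN j v : (j < n)%N -> v \in nodes (V j) -> (emargin r (complete_union v) x < +oo)%E.
  case: j v => [|j] v jn; first by rewrite [emargin _ _ _]e1 ltry.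
  by rewrite (vine_nodes hV jn); apply: hfin; apply: ltnW.
have finD j e : (0 < j)%N -> (j < n)%N -> e \in edges (V j) ->
    (emargin r (@conditioning_set n.+1 j e) x < +oo)%E.
  case: j e => // j e _ jn eE; have [c cN ->] := vine_conditioning_node hV jn eE.
  exact: finN (ltnW jn) cN.
have : 0 <= r x by case: hr => _ h _ _; apply: h.
rewrite le_eqVlt => /predU1P[/esym rx|rx].
  (* If r(x) = 0, the factor of the single top edge vanishes, its complete union being the set of
     all coordinates. *)
  have [e Ee eT] := vine_top_edge hV n0.
  have eE : e \in edges (V n.-1) by rewrite Ee finset.in_set1.
  have top : (n.-1 < n)%N by rewrite prednK.
  have [pq pD qD _] := vine_edge_shape hV top eE.
  rewrite [X in _ * X](bigD1_seq n.-1) ?mem_index_iota ?iota_uniq //=; last by lia.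
  rewrite (bigD1 e) //= pair_copula_density_eq0 ?mul0r ?mulr0 //.
    by apply: finD eE => //; lia.
  by rewrite -(vine_edge_union hV top eE).
(* If r(x) > 0, the margins involved are positive and finite, and the telescoping product agrees
   with the formula factor by factor. *)
have -> : r x = margin r [set: 'I_n.+1]%SET x by rewrite /margin emargin_setT.
rewrite (vine_telescope hV (m := fun J => margin r J x)) //; last 2 first.
- by move=> i; rewrite /margin e1.
- by move=> j jn e eE; rewrite gt_eqF // margin_gt0 // hfin.
congr (_ * _); first by apply: eq_bigr => e eE; rewrite (vine_first_edge hV n0 eE).
apply: eq_big_nat => j /andP[j0 jn]; apply: eq_bigr => e eE /=.
have [pq pD qD [a [b [ee ab ua ub]]]] := vine_edge_shape hV jn eE.
rewrite pair_copula_density_gt0 // ?finD // -(vine_edge_union hV jn eE).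
congr (_ / _); rewrite {1}ee big_setU1 ?finset.in_set1 // big_set1 ua ub.
by [].
Qed.
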